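(* Let $\varphi\in\mathcal C$ and $K\in\mathcal K^n_o$. Then for all $i=1,2,\dots,n$, $$\frac{\sqrt2}{2\varphi^{-1}(1/2)}\sqrt{\frac{i+1}{i}}\;R_i(K)\ \le\ R_i(K+_\varphi(-K))\ \le\ 2R_i(K),$$ $$\frac{1}{\varphi^{-1}(1/2)}\,r_i(K)\ \le\ r_i(K+_\varphi(-K))\ <\ 2(i+1)\,r_i(K).$$
   Context: $\mathcal C$ is the class of convex, strictly increasing functions $\varphi:[0,\infty)\to[0,\infty)$ with $\varphi(0)=0$ and $\varphi(1)=1$. A convex body in $\mathbb R^n$ is a compact convex subset with nonempty interior; $\mathcal K^n_o$ is the class of convex bodies in $\mathbb R^n$ containing the origin. The support function of $K$ is $h_K(x)=\max_{y\in K}\langle x,y\rangle$. For $\varphi\in\mathcal C$ and $K,L\in\mathcal K^n_o$, the Orlicz Minkowski sum $K+_\varphi L$ is the convex body with support function $$h_{K+_\varphi L}(x)=\inf\{\lambda>0:\varphi(h_K(x)/\lambda)+\varphi(h_L(x)/\lambda)\le 1\}.$$ Here $-K=\{-x:x\in K\}$. $\mathcal L^n_i$ is the set of $i$-dimensional linear subspaces of $\mathbb R^n$, $L^\bot$ is the orthogonal complement of $L$, $K|L$ is the orthogonal projection of $K$ onto $L$, and $R(\cdot)$ is the circumradius. For $i=1,\dots,n$ the successive outer and inner radii are $R_i(K)=\min_{L\in\mathcal L^n_i}R(K|L)$ and $r_i(K)=\max_{L\in\mathcal L^n_i}\max_{x\in L^\bot}r(K\cap(x+L);x+L)$, where $r(M;x+L)$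 is the inradius of $M$ taken relative to the affine subspace $x+L$; equivalently, $r_i(K)$ is the radius of the largest $i$-dimensional ball contained in $K$. *)

(* Defs.v *)
From HB Require Import structures.
From mathcomp Require Import all_boot all_order all_algebra.
From mathcomp Require Import all_classical all_reals all_analysis.
Set Implicit Arguments.
Unset Strict Implicit.
Unset Printing Implicit Defensive.
Import Order.TTheory GRing.Theory Num.Theory.
Import numFieldNormedType.Exports.
Local Open Scope classical_set_scope.
Local Open Scope ring_scope.

(* R^n is ['rV[R]_n]: its library topology is the usual one, but its library
   norm [`|x|] is the sup norm, hence the explicit Euclidean structure. *)

Definition dot (R : realType) (n : nat) (x y : 'rV[R]_n) : R :=
  \sum_(i < n) x 0 i * y 0 i.

Definition enorm (R : realType) (n : nat) (x : 'rV[R]_n) : R :=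
  Num.sqrt (dot x x).

Definition eball (R : realType) (n : nat) (c : 'rV[R]_n) (rho : R) :
    set 'rV[R]_n :=
  [set y | enorm (y - c) <= rho].

Definition convex_body (R : realType) (n : nat) (K : set 'rV[R]_n) : Prop :=
  [/\ compact K, convex_set K & interior K !=set0].

Definition convex_body_o (R : realType) (n : nat) (K : set 'rV[R]_n) : Prop :=
  convex_body K /\ K 0.

Definition support (R : realType) (n : nat) (K : set 'rV[R]_n)
    (x : 'rV[R]_n) : R :=
  sup [set dot x y | y in K].

(* A function on [0, oo) is represented by a total function on R whose values
   at negative arguments are irrelevant. *)
Definition orlicz_class (R : realType) (phi : R -> R) : Prop :=
  [/\ convex_function (`[0, +oo[%classic : set R^o) phi,
      {in `[0, +oo[ &, {homo phi : s t / s < t}},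
      {in `[0, +oo[, forall t, 0 <= phi t},
      phi 0 = 0
    & phi 1 = 1].

Definition orlicz_inv (R : realType) (phi : R -> R) : R -> R :=
  'pinv_(fun=> 0) `[0, +oo[%classic phi.

Definition orlicz_support (R : realType) (n : nat) (phi : R -> R)
    (K L : set 'rV[R]_n) (x : 'rV[R]_n) : R :=
  inf [set lambda : R | 0 < lambda /\
    phi (support K x / lambda) + phi (support L x / lambda) <= 1].

(* The convex body with support function [orlicz_support phi K L]; a convex
   body is determined by its support function, so at most one set qualifies. *)
Definition orlicz_sum (R : realType) (n : nat) (phi : R -> R)
    (K L : set 'rV[R]_n) : set 'rV[R]_n :=
  xget set0 [set M : set 'rV[R]_n | convex_body M /\
    forall x, support M x = orlicz_support phi K L x].

Definition reflection (R : realType) (n : nat) (K : set 'rV[R]_n) :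
    set 'rV[R]_n :=
  [set - x | x in K].

Definition subspaces (R : realType) (n i : nat) : set {vspace 'rV[R]_n} :=
  [set L | \dim L = i].

Definition orthocomp (R : realType) (n : nat) (L : {vspace 'rV[R]_n}) :
    set 'rV[R]_n :=
  [set x | forall y, y \in L -> dot x y = 0].

Definition projection (R : realType) (n : nat) (K : set 'rV[R]_n)
    (L : {vspace 'rV[R]_n}) : set 'rV[R]_n :=
  [set p | p \in L /\ exists2 x, K x & orthocomp L (x - p)].

Definition translate (R : realType) (n : nat) (x : 'rV[R]_n)
    (L : {vspace 'rV[R]_n}) : set 'rV[R]_n :=
  [set x + v | v in [set v | v \in L]].

Definition circumradius (R : realType) (n : nat) (M : set 'rV[R]_n) : R :=
  inf [set rho : R | 0 <= rho /\ exists c, M `<=` eball c rho].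

(* For empty [M] this is [sup set0 = 0], which does not affect the maximum in
   [inner_radius]. *)
Definition rel_inradius (R : realType) (n : nat) (M A : set 'rV[R]_n) : R :=
  sup [set rho : R | 0 <= rho /\
    exists2 c, A c & eball c rho `&` A `<=` M].

Definition outer_radius (R : realType) (n i : nat) (K : set 'rV[R]_n) : R :=
  inf [set circumradius (projection K L) | L in @subspaces R n i].

Definition inner_radius (R : realType) (n i : nat) (K : set 'rV[R]_n) : R :=
  sup [set sup [set rel_inradius (K `&` translate x L) (translate x L)
                 | x in orthocomp L]
        | L in @subspaces R n i].

(* Main.v *)
Require Import Defs.
From mathcomp Require Import all_boot all_order all_algebra.
From mathcomp Require Import all_classical all_reals all_analysis.
From mathcomp Require Import ring lra.
Import Order.TTheory GRing.Theory Num.Theory.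
Import numFieldNormedType.Exports.
(* [support] would otherwise denote the nonzero set of a function. *)
Import Defs.
Set Implicit Arguments.
Unset Strict Implicit.
Unset Printing Implicit Defensive.
Local Open Scope classical_set_scope.
Local Open Scope ring_scope.

(** Let [s] be the preimage of [1 / 2] by [phi]. As [phi t <= t] on [0, 1], the
    support function of [M], the Orlicz sum of [K] and [- K], is at most that
    of [K - K]; and by Jensen's inequality for the two values of [phi] it is at
    least [1 / (2 s)] times the latter. Hence
      (2 s)^-1 (K - K)  is contained in  M,  which is contained in  K - K
    ([sub_orlicz_sum], [orlicz_sum_sub]). This uses that [M] exists, i.e. that
    a sublinear function is the support function of a compact convex set (a
    finite dimensional [hahn_banach] theorem), and that a convex body is
    determined by its support function ([separation]). All four inequalities
    then follow from comparisons between a body and its difference body.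

    Outer radii. If a ball of radius [r] contains the projection of [K], the
    ball of radius [2 r] around the origin contains that of [K - K]. Conversely
    a ball of radius [r] containing the projection of [K - K] forces the
    projection of [K] to have diameter at most [r], by symmetry; [jung]'s
    theorem in dimension [i] then bounds its circumradius by
    [r * sqrt (i / (2 (i + 1)))].

    Inner radii. An [i]-ball of radius [r] in [K] yields one of radius [2 r] in
    [K - K]. Conversely, if [K - K] contains an [i]-ball of radius [r], then
    [K] contains translates of the segments from [0] to [r e_j] for an
    orthonormal basis [e_1 .. e_i] of its direction, hence by convexity their
    mean, which is a cube with edges [r / i]. So [r <= 2 i r_i(K)], and
    [r_i(K) > 0] turns this into the strict inequality with [i + 1]. *)

(** * The Euclidean structure *)

Section Euclidean.
Variables (R : realType) (n : nat).
Implicit Types x y z : 'rV[R]_n.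

Lemma dotE x y : dot x y = (x *m y^T) 0 0.
Proof. by rewrite mxE; apply: eq_bigr => j _; rewrite !mxE. Qed.

Lemma dotC x y : dot x y = dot y x.
Proof. by apply: eq_bigr => j _; rewrite mulrC. Qed.

Lemma dotDl x y z : dot (x + y) z = dot x z + dot y z.
Proof. by rewrite !dotE mulmxDl mxE. Qed.

Lemma dotNl x y : dot (- x) y = - dot x y.
Proof. by rewrite !dotE mulNmx mxE. Qed.

Lemma dotZl a x y : dot (a *: x) y = a * dot x y.
Proof. by rewrite !dotE -scalemxAl mxE. Qed.

Lemma dot0l y : dot 0 y = 0.
Proof. by rewrite dotE mul0mx mxE. Qed.

Lemma dotDr x y z : dot x (y + z) = dot x y + dot x z.
Proof. by rewrite dotC dotDl !(dotC x). Qed.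

Lemma dotNr x y : dot x (- y) = - dot x y.
Proof. by rewrite dotC dotNl dotC. Qed.

Lemma dotZr a x y : dot x (a *: y) = a * dot x y.
Proof. by rewrite dotC dotZl dotC. Qed.

Lemma dot0r x : dot x 0 = 0.
Proof. by rewrite dotC dot0l. Qed.

Lemma dot_suml (I : finType) (F : I -> 'rV[R]_n) y :
  dot (\sum_i F i) y = \sum_i dot (F i) y.
Proof.
apply: (big_morph (fun v => dot v y)); last exact: dot0l.
by move=> u v; rewrite dotDl.
Qed.

Lemma dot_sumr (I : finType) (F : I -> 'rV[R]_n) x :
  dot x (\sum_i F i) = \sum_i dot x (F i).
Proof. by rewrite dotC dot_suml; apply: eq_bigr => j _; rewrite dotC. Qed.

Lemma dot_ge0 x : 0 <= dot x x.
Proof. by apply: sumr_ge0 => j _; rewrite -expr2 sqr_ge0. Qed.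

Lemma dot_eq0 x : (dot x x == 0) = (x == 0).
Proof.
apply/eqP/eqP => [x0|->]; last exact: dot0l.
have xj0 : forall j, true -> x 0 j * x 0 j = 0.
  by apply: psumr_eq0P x0 => j _; rewrite -expr2 sqr_ge0.
apply/rowP => j; rewrite mxE.
by have /eqP := xj0 j isT; rewrite mulf_eq0 orbb => /eqP.
Qed.

Lemma dot_gt0 x : (0 < dot x x) = (x != 0).
Proof. by rewrite lt_neqAle dot_ge0 andbT eq_sym dot_eq0. Qed.

Lemma dot_delta x j : dot x (delta_mx 0 j) = x 0 j.
Proof.
rewrite /dot (bigD1 j)//= mxE !eqxx mulr1 big1 ?addr0// => k kj.
by rewrite mxE eqxx (negbTE kj) mulr0.
Qed.

Lemma dot_sqrD x y a :
  dot (x + a *: y) (x + a *: y) = dot x x + 2 * a * dot x y + a ^+ 2 * dot y y.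
Proof. by rewrite !(dotDl, dotDr, dotZl, dotZr) (dotC y x); ring. Qed.

Lemma enorm_le x r : 0 <= r -> (enorm x <= r) = (dot x x <= r ^+ 2).
Proof.
by move=> r0; rewrite -(ler_sqrt _ (sqr_ge0 r)) sqrtr_sqr ger0_norm.
Qed.

(** The parallelogram law replaces the triangle inequality in comparisons of
    diameters with circumradii. *)
Lemma dot_subr_le x y r :
  dot x x <= r -> dot y y <= r -> dot (x - y) (x - y) <= 4 * r.
Proof.
have := dot_ge0 (x + y).
rewrite !(dotDl, dotDr, dotNl, dotNr) (dotC y x); lra.
Qed.

Lemma dot_continuous x : continuous (dot x).
Proof.
rewrite (_ : dot x = (fun y => \sum_i x 0 i * y 0 i))//.
move=> y; apply: (cvg_big (F := nbhs y) add_continuous) => j _.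
apply: cvgM; first exact: cvg_cst.
exact: coord_continuous.
Qed.

Lemma dot_square_continuous : continuous (fun x : 'rV[R]_n => dot x x).
Proof.
move=> y; rewrite /dot; apply: (cvg_big (F := nbhs y) add_continuous) => j _.
by apply: cvgM; exact: coord_continuous.
Qed.

Lemma coord_le_norm x j : `|x 0 j| <= `|x|.
Proof.
rewrite [leRHS]/Num.norm /= mx_normrE; apply/bigmax_geP; right => /=.
by exists (0, j).
Qed.

Lemma dot_le_norm x : dot x x <= n%:R * `|x| ^+ 2.
Proof.
rewrite mulr_natl -[n in _ *+ n]card_ord -sumr_const; apply: ler_sum => j _.
rewrite -expr2 -real_normK ?num_real// ler_pXn2r ?nnegrE//.
exact: coord_le_norm.
Qed.

Lemma norm_le_dot x : `|x| ^+ 2 <= dot x x.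
Proof.
have [->|x0] := eqVneq x 0; first by rewrite normr0 dot0l expr0n.
have /mx_norm_neq0[[i j]/= xij] : mx_norm x != 0.
  by rewrite -(normr_eq0 x) in x0.
rewrite [`|x|]xij {i xij}(ord1 i) real_normK ?num_real//.
rewrite /dot (bigD1 j)//= -expr2 lerDl.
by apply: sumr_ge0 => k _; rewrite -expr2 sqr_ge0.
Qed.

End Euclidean.

(** * Orthonormal bases of subspaces *)

(** Vectors of the subspace are recognised, and projected onto it, by the
    coordinates in an orthonormal basis, kept as the rows of [E]. *)
Definition orthonormal_rows (R : realType) (n i : nat) (E : 'M[R]_(i, n))
    (L : {vspace 'rV[R]_n}) : Prop :=
  E *m E^T = 1%:M /\ forall v, v \in L <-> v *m E^T *m E = v.

Section OrthonormalBasis.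
Variables (R : realType) (n : nat).
Implicit Types L : {vspace 'rV[R]_n}.

Lemma gram_schmidt (X : seq 'rV[R]_n) :
  exists Y : seq 'rV[R]_n, [/\ <<Y>>%VS = <<X>>%VS,
    {in Y, forall u, dot u u = 1} & pairwise (fun u v => dot u v == 0) Y].
Proof.
elim: X => [|x X [Y [spanY unitY orthY]]]; first by exists [::].
pose p := \sum_(u <- Y) dot x u *: u; pose r := x - p.
have pY : p \in <<Y>>%VS.
  rewrite /p big_seq; apply: memv_suml => u uY; apply: memvZ.
  exact: memv_span.
have r_orth u : u \in Y -> dot r u = 0.
  move=> uY; rewrite /r dotDl dotNl; apply/eqP; rewrite subr_eq0; apply/eqP.
  rewrite /p; move: (dot x) => f; move: uY unitY orthY; elim: (Y) => // v Z IH.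
  rewrite inE big_cons dotDl dotZl => uvZ unitvZ /= /andP[/allP vZ orthZ].
  have unitZ : {in Z, forall u, dot u u = 1}.
    by move=> w wZ; apply: unitvZ; rewrite inE wZ orbT.
  have [uZ|uZ] := boolP (u \in Z).
    by rewrite -IH// (eqP (vZ u uZ)) mulr0 add0r.
  move: uvZ; rewrite (negbTE uZ) orbF => /eqP uv; rewrite uv in uZ *.
  rewrite unitvZ ?mem_head// mulr1.
  suff -> : dot (\sum_(w <- Z) f w *: w) v = 0 by rewrite addr0.
  have {}vZ : {in Z, forall w, dot w v = 0}.
    by move=> w wZ; rewrite dotC (eqP (vZ w wZ)).
  elim: (Z) vZ {IH uZ unitvZ orthZ unitZ} => [|w Z' IH] vZ.
    by rewrite big_nil dot0l.
  rewrite big_cons dotDl dotZl vZ ?mem_head// mulr0 add0r IH// => w' w'Z.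
  by apply: vZ; rewrite inE w'Z orbT.
have [r0|r0] := eqVneq r 0.
  exists Y; split => //; rewrite span_cons -spanY.
  apply/esym/addv_idPr; rewrite -memvE.
  by move/eqP: r0; rewrite subr_eq0 => /eqP ->.
exists ((Num.sqrt (dot r r))^-1 *: r :: Y); split.
- have s0 : (Num.sqrt (dot r r))^-1 != 0.
    by rewrite invr_eq0 sqrtr_eq0 -ltNge dot_gt0.
  rewrite !span_cons -spanY; apply/vspaceP => v; apply/idP/idP.
    apply/subvP: v; rewrite subv_add addvSr andbT -memvE memvZ//.
    by rewrite /r memvB ?(subvP (addvSl _ _) _ (memv_line x))//
      (subvP (addvSr _ _)).
  apply/subvP: v; rewrite subv_add addvSr andbT -memvE.
  have -> : x = r + p by rewrite subrK.
  apply: memvD; last exact: (subvP (addvSr _ _)).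
  apply: (subvP (addvSl _ _)).
  rewrite -[X in X \in _](scalerK s0) memvZ//; exact: memv_line.
- move=> u; rewrite inE => /orP[/eqP ->|/unitY//].
  rewrite dotZl dotZr mulrA -invfM -expr2 sqr_sqrtr ?dot_ge0//.
  by rewrite mulVf// dot_eq0.
- rewrite /= orthY andbT; apply/allP => u /r_orth ru.
  by rewrite dotZl ru mulr0.
Qed.

Lemma orthonormal_free (Y : seq 'rV[R]_n) : {in Y, forall u, dot u u = 1} ->
  pairwise (fun u v => dot u v == 0) Y -> free Y.
Proof.
elim: Y => [|u Y IH] unitY /=; first by rewrite nil_free.
move=> /andP[/allP uY orthY]; rewrite free_cons; apply/andP; split; last first.
  by apply: IH => // w wY; apply: unitY; rewrite inE wY orbT.
apply/negP => uspan.
have : dot u u = 0.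
  rewrite {2}(@coord_span _ _ _ (in_tuple Y) _ uspan) dot_sumr big1// => j _.
  by rewrite dotZr (eqP (uY _ (mem_nth 0 _))) ?mulr0.
by rewrite unitY ?mem_head// => /eqP; rewrite oner_eq0.
Qed.

Lemma orthonormal_basis (i : nat) L :
  \dim L = i -> exists E : 'M[R]_(i, n), orthonormal_rows E L.
Proof.
move=> dimL; have [Y [spanY unitY orthY]] := gram_schmidt (vbasis L).
have YL : <<Y>>%VS = L by rewrite spanY (span_basis (vbasisP L)).
have sizeY : size Y = i.
  by have := orthonormal_free unitY orthY; rewrite /free YL dimL => /eqP.
have orth (j k : 'I_i) : j != k -> dot Y`_j Y`_k = 0.
  have lt (j' k' : 'I_i) : (j' < k')%N -> dot Y`_j' Y`_k' = 0.
    move=> jk; apply/eqP; move/pairwiseP : orthY => /(_ 0); apply => //.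
    - by rewrite inE sizeY.
    - by rewrite inE sizeY.
  rewrite -val_eqE neq_ltn => /orP[/lt//|/lt]; by rewrite dotC.
exists (\matrix_(j < i) Y`_j).
have EE : (\matrix_(j < i) Y`_j) *m (\matrix_(j < i) Y`_j)^T = 1%:M.
  apply/matrixP => j k; rewrite mxE.
  transitivity (dot Y`_j Y`_k).
    by apply: eq_bigr => l _; rewrite !mxE.
  rewrite mxE; have [->|jk] := eqVneq j k; last exact: orth.
  by rewrite unitY// mem_nth// sizeY.
split=> // v; split => [vL|<-].
  have sizeY' : size Y == i by rewrite sizeY.
  have vY : v \in <<Tuple sizeY'>>%VS by rewrite /= YL.
  have -> : v = (\row_j coord (Tuple sizeY') j v) *m \matrix_(j < i) Y`_j.
    rewrite {1}(coord_span vY); apply/rowP => l.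
    rewrite summxE mxE; apply: eq_bigr => j _.
    by rewrite !mxE.
  by rewrite -!mulmxA (mulmxA _ _^T) EE mul1mx.
rewrite mulmx_sum_row -YL; apply: memv_suml => j _; apply: memvZ.
by rewrite rowK memv_span// mem_nth// sizeY.
Qed.

End OrthonormalBasis.

(** * Jung's theorem *)

Section Jung.
Variable R : realType.

Definition weights (k : nat) (w : 'I_k -> R) : Prop :=
  (forall j, 0 <= w j) /\ \sum_j w j = 1.

Definition variance (m k : nat) (w : 'I_k -> R) (p : 'I_k -> 'rV[R]_m) : R :=
  \sum_j w j * dot (p j) (p j)
  - dot (\sum_j w j *: p j) (\sum_j w j *: p j).

Lemma variance_pairs (m k : nat) (w : 'I_k -> R) (p : 'I_k -> 'rV[R]_m) :
  \sum_j w j = 1 ->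
  2 * variance w p = \sum_j \sum_l w j * (w l * dot (p j - p l) (p j - p l)).
Proof.
move=> w1; pose a j := dot (p j) (p j).
have -> : \sum_j \sum_l w j * (w l * dot (p j - p l) (p j - p l)) =
    \sum_j \sum_l (w j * a j) * w l + \sum_j \sum_l w j * (w l * a l)
    + (- 2) * \sum_j \sum_l w j * (w l * dot (p j) (p l)).
  rewrite [X in _ + X]mulr_sumr -!big_split/=; apply: eq_bigr => j _.
  rewrite [X in _ + X]mulr_sumr -!big_split/=; apply: eq_bigr => l _.
  rewrite /a !(dotDl, dotDr, dotNl, dotNr) (dotC (p l) (p j)); ring.
have -> : \sum_j \sum_l (w j * a j) * w l = \sum_j w j * a j.
  by apply: eq_bigr => j _; rewrite -mulr_sumr w1 mulr1.
have -> : \sum_j \sum_l w j * (w l * a l) = \sum_j w j * a j.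
  under eq_bigr do rewrite -mulr_sumr.
  by rewrite -mulr_suml w1 mul1r.
have -> : \sum_j \sum_l w j * (w l * dot (p j) (p l)) =
    dot (\sum_j w j *: p j) (\sum_j w j *: p j).
  rewrite dot_suml; apply: eq_bigr => j _.
  rewrite dot_sumr; apply: eq_bigr => l _.
  by rewrite dotZl dotZr.
rewrite /variance -/(a _); ring.
Qed.

Lemma sum_sqr_weights (m : nat) (w : 'I_m.+1 -> R) :
  \sum_j w j = 1 -> m.+1%:R^-1 <= \sum_j w j ^+ 2.
Proof.
move=> w1; pose u : R := m.+1%:R^-1.
have : 0 <= \sum_j (w j - u) ^+ 2 by apply: sumr_ge0 => j _; exact: sqr_ge0.
have -> : \sum_j (w j - u) ^+ 2 = \sum_j w j ^+ 2 - u.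
  rewrite [RHS](_ : _ = \sum_j w j ^+ 2 + (- 2 * u) * \sum_j w j
      + \sum_(j < m.+1) u ^+ 2); last first.
    have uE : u ^+ 2 *+ m.+1 = u by rewrite -mulr_natr expr2 -mulrA mulVf ?mulr1.
    rewrite w1 sumr_const card_ord uE; ring.
  rewrite mulr_sumr -!big_split/=; apply: eq_bigr => j _; ring.
by rewrite subr_ge0.
Qed.

(** Only the off-diagonal pairs contribute to the variance, and they carry at
    most the fraction [1 - 1 / (m + 1)] of the weight of all pairs. *)
Lemma variance_le (m d : nat) (w : 'I_m.+1 -> R) (p : 'I_m.+1 -> 'rV[R]_d) D :
  weights w -> (forall j l, dot (p j - p l) (p j - p l) <= D) ->
  variance w p <= D * (m%:R / (2 * m.+1%:R)).
Proof.
move=> [w0 w1] pD.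
have D0 : 0 <= D by apply: le_trans (pD ord0 ord0); exact: dot_ge0.
have : 2 * variance w p <= D * (1 - \sum_j w j ^+ 2).
  rewrite variance_pairs// -{1}w1 -sumrB mulr_sumr; apply: ler_sum => j _.
  rewrite -mulr_sumr (bigD1 j)//= subrr dot0l mulr0 add0r.
  have -> : D * (w j - w j ^+ 2) = w j * \sum_(l | l != j) w l * D.
    rewrite -mulr_suml; have : \sum_(l | l != j) w l = 1 - w j.
      by rewrite -w1 [in RHS](bigD1 j)//= addrC addrK.
    move=> ->; ring.
  by apply: ler_wpM2l => //; apply: ler_sum => l _; apply: ler_wpM2l.
have := sum_sqr_weights w1.
have -> : m%:R / (2 * m.+1%:R) = (1 - m.+1%:R^-1) / 2 :> R.
  rewrite -[in LHS]natr1 -[in RHS]natr1; field.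
  by rewrite natr1 pnatr_eq0.
move: (\sum_j _) (m.+1%:R^-1) => s u us; nra.
Qed.

(** Carathéodory: along an affine dependency of the points, the barycenter is
    constant and the variance affine in the weights, so one point can be
    discarded without decreasing the variance. *)
Lemma variance_reduce (m : nat) (w : 'I_m.+2 -> R) (p : 'I_m.+2 -> 'rV[R]_m) :
  weights w -> exists (w' : 'I_m.+1 -> R) (f : 'I_m.+1 -> 'I_m.+2),
    weights w' /\ variance w p <= variance w' (p \o f).
Proof.
move=> [w0 w1].
have [mu [mu_neq0 mu_sum mu_p mu_a]] : exists mu : 'I_m.+2 -> R,
    [/\ exists j, mu j != 0, \sum_j mu j = 0, \sum_j mu j *: p j = 0
      & 0 <= \sum_j mu j * dot (p j) (p j)].
  pose A : 'M[R]_(m.+2, m + 1) := row_mx (\matrix_j p j) (const_mx 1).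
  have : kermx A != 0.
    rewrite -mxrank_eq0 mxrank_ker -lt0n subn_gt0.
    by rewrite (leq_ltn_trans (rank_leq_col A))// addn1.
  move=> /rowV0Pn[v /sub_kermxP]; rewrite mul_mx_row -row_mx0 => /eq_row_mx.
  move=> [vp v1] v_neq0.
  have [j vj] : exists j, v 0 j != 0.
    apply/existsP; apply: contra_neqT v_neq0 => /existsPn vj.
    by apply/rowP => j; rewrite mxE; apply/eqP; rewrite -[_ == _]negbK vj.
  have vsum : \sum_j v 0 j = 0.
    move/rowP/(_ 0) : v1; rewrite !mxE => v1; rewrite -[RHS]v1.
    by apply: eq_bigr => l _; rewrite mxE mulr1.
  have vp0 : \sum_j v 0 j *: p j = 0.
    by rewrite -[RHS]vp mulmx_sum_row; apply: eq_bigr => l _; rewrite rowK.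
  have [va|va] := leP 0 (\sum_j v 0 j * dot (p j) (p j)).
    by exists (v 0); split => //; exists j.
  exists (fun l => - v 0 l); split.
  - by exists j; rewrite oppr_eq0.
  - by rewrite sumrN vsum oppr0.
  - by under eq_bigr do rewrite scaleNr; rewrite sumrN vp0 oppr0.
  - by under eq_bigr do rewrite mulNr; rewrite sumrN oppr_ge0 ltW.
have [j1 mu_j1] : exists j, mu j < 0.
  case: mu_neq0 => j mu_j; apply/existsP; apply: contraNT mu_j => /existsPn mu0.
  have {}mu0 : forall l, true -> 0 <= mu l by move=> l _; rewrite leNgt mu0.
  by rewrite (psumr_eq0P mu0 mu_sum).
case: (@Order.TotalTheory.arg_minP _ _ _ j1 (fun j => mu j < 0)
  (fun j => w j / - mu j) mu_j1) => j0 mu_j0 j0_min.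
pose t := w j0 / - mu j0; pose u j := w j + t * mu j.
have t0 : 0 <= t by rewrite divr_ge0// oppr_ge0 ltW.
have u0 j : 0 <= u j.
  have [muj|muj] := leP 0 (mu j); first by rewrite addr_ge0// mulr_ge0.
  have := j0_min _ muj; rewrite -/t ler_pdivlMr ?oppr_gt0// /u; lra.
have uj0 : u j0 = 0 by rewrite /u /t invrN mulrN mulNr divfK ?subrr// lt_eqF.
have usum (F : 'I_m.+2 -> R) :
    \sum_j u j * F j = \sum_l u (lift j0 l) * F (lift j0 l).
  by rewrite (bigD1_ord j0)//= uj0 mul0r add0r.
have usump : \sum_j u j *: p j = \sum_l u (lift j0 l) *: p (lift j0 l).
  by rewrite (bigD1_ord j0)//= uj0 scale0r add0r.
exists (u \o lift j0), (lift j0); split; [split|] => //=.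
  transitivity (\sum_l u (lift j0 l) * 1).
    by apply: eq_bigr => l _; rewrite mulr1.
  rewrite -(usum (fun=> 1)); under eq_bigr do rewrite mulr1.
  by rewrite big_split/= -mulr_sumr mu_sum mulr0 addr0.
rewrite /variance /= -(usum (fun j => dot (p j) (p j))) -usump.
have -> : \sum_j u j *: p j = \sum_j w j *: p j.
  under eq_bigr do rewrite scalerDl -scalerA.
  by rewrite big_split/= -scaler_sumr mu_p scaler0 addr0.
rewrite lerD2r; under [leRHS]eq_bigr do rewrite mulrDl -mulrA.
by rewrite big_split/= -mulr_sumr lerDl mulr_ge0.
Qed.

(** Jung's theorem. For a nearly maximal variance over [m + 1] points of [C],
    mixing in a further point [q] with a small weight would increase the
    variance if [q] were far from the barycenter; so the barycenter is the
    centre of a ball around [C]. *)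
Theorem jung (m : nat) (C : set 'rV[R]_m) (D r : R) : 0 <= r ->
  (forall x y, C x -> C y -> dot (x - y) (x - y) <= D) ->
  D * (m%:R / (2 * m.+1%:R)) < r ^+ 2 ->
  exists c, C `<=` eball c r.
Proof.
move=> r0 CD Dr.
have [->|/set0P[x0 Cx0]] := eqVneq C set0; first by exists 0.
pose V := [set v | exists (w : 'I_m.+1 -> R) (p : 'I_m.+1 -> 'rV[R]_m),
  [/\ weights w, forall j, C (p j) & v = variance w p]].
have Vub : ubound V (D * (m%:R / (2 * m.+1%:R))).
  by move=> _ [w [p [ww Cp ->]]]; apply: variance_le => // j l; exact: CD.
have avg1 : \sum_(j < m.+1) m.+1%:R^-1 = 1 :> R.
  by rewrite sumr_const card_ord -[LHS]mulr_natl mulfV.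
have V0 : V 0.
  exists (fun=> m.+1%:R^-1), (fun=> x0); split => //.
  by rewrite /variance -mulr_suml -scaler_suml avg1 scale1r mul1r subrr.
have supV : has_sup V by split; [exists 0|exists (D * (m%:R / (2 * m.+1%:R)))].
set S := sup V.
have S0 : 0 <= S by exact: ub_le_sup supV.2 _ V0.
have Sr : S < r ^+ 2 by apply: le_lt_trans Dr; apply: ge_sup => //; exists 0.
(* this [e] makes [(S + e) / (1 - e)] equal to [r ^+ 2] *)
pose e := (r ^+ 2 - S) / (1 + r ^+ 2).
have r2 : 0 < 1 + r ^+ 2 by rewrite ltr_pwDl// sqr_ge0.
have e0 : 0 < e by rewrite divr_gt0// subr_gt0.
have e1 : e < 1 by rewrite ltr_pdivrMr//; lra.
have eE : e * (1 + r ^+ 2) = r ^+ 2 - S by rewrite divfK// gt_eqF.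
have [_ [w [p [ww Cp ->]]] wpS] := sup_adherent (exprn_gt0 2 e0) supV.
rewrite -/S in wpS.
pose c := \sum_j w j *: p j.
exists c => q Cq; rewrite /eball/= enorm_le//.
have [w0 w1] := ww.
pose w' (j : 'I_m.+2) := if unlift ord0 j is Some l then (1 - e) * w l else e.
pose p' (j : 'I_m.+2) := if unlift ord0 j is Some l then p l else q.
have ww' : weights w'.
  split=> [j|].
    rewrite /w'; case: unliftP => [l _|_]; last exact: ltW.
    by rewrite mulr_ge0// subr_ge0 ltW.
  rewrite big_ord_recl /w' unlift_none; under eq_bigr do rewrite liftK.
  by rewrite -mulr_sumr w1 mulr1 addrC subrK.
have [w'' [f [ww'' w'w'']]] := variance_reduce p' ww'.
have : variance w' p' <= S.
  apply: le_trans w'w'' _; apply: ub_le_sup => //; first exact: supV.2.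
  exists w'', (p' \o f); split => // j /=.
  by rewrite /p'; case: unliftP.
have -> : variance w' p' =
    (1 - e) * variance w p + e * (1 - e) * dot (q - c) (q - c).
  rewrite /variance.
  have -> : \sum_j w' j *: p' j = e *: q + (1 - e) *: c.
    rewrite big_ord_recl /w' /p' unlift_none scaler_sumr; congr (_ + _).
    by apply: eq_bigr => l _; rewrite liftK scalerA.
  have -> : \sum_j w' j * dot (p' j) (p' j) =
      e * dot q q + (1 - e) * \sum_j w j * dot (p j) (p j).
    rewrite big_ord_recl /w' /p' unlift_none [X in _ = _ + X]mulr_sumr.
    congr (_ + _).
    by apply: eq_bigr => l _; rewrite liftK mulrA.
  rewrite -/c.
  rewrite !(dotDl, dotDr, dotNl, dotNr, dotZl, dotZr) (dotC c q); ring.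
set d := dot _ _ => VS.
have : (1 - e) * d <= S + e.
  rewrite -(ler_pM2l e0); move: wpS VS; move: (variance w p) => v.
  nra.
have -> : S + e = (1 - e) * r ^+ 2 by move: eE; lra.
by rewrite ler_pM2l// subr_gt0.
Qed.

End Jung.

(** * Support functions of compact convex sets *)

Section ConvexSets.
Variables (R : realType) (n : nat).
Implicit Types (K L C : set 'rV[R]_n) (p : 'rV[R]_n -> R).

Lemma convex_setP C : convex_set C <-> forall x y t, C x -> C y ->
  0 <= t -> t <= 1 -> C (t *: x + (1 - t) *: y).
Proof.
split=> [cC x y t Cx Cy t0 t1|cC x y t].
  by have /(_ (mem_set Cx) (mem_set Cy)) := @cC x y (Itv01 t0 t1); rewrite inE.
rewrite !inE => Cx Cy; apply: cC => //.
Qed.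

Lemma convex_mean C (k : nat) (p : 'I_k.+1 -> 'rV[R]_n) : convex_set C ->
  (forall j, C (p j)) -> C (k.+1%:R^-1 *: \sum_j p j).
Proof.
move=> /convex_setP cC; elim: k p => [|k IH] p Cp.
  by rewrite invr1 scale1r big_ord1.
rewrite big_ord_recl; set u : R := k.+2%:R^-1; set v : R := k.+1%:R^-1.
have uv : 1 - u = u * v^-1.
  have : u * k.+2%:R = 1 by rewrite mulVf ?pnatr_eq0.
  rewrite /v invrK -natr1; lra.
have v0 : v != 0 by rewrite invr_eq0 pnatr_eq0.
have := cC _ _ u (Cp ord0) (IH (fun l => p (lift ord0 l)) (fun l => Cp _)).
rewrite invr_ge0 ler0n invf_le1 ?ler1n ?ltr0n// => /(_ isT isT).
by rewrite uv !scalerA -/v mulfVK// -scalerDr.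
Qed.

Lemma support_has_sup K x : K !=set0 -> compact K ->
  has_sup [set dot x y | y in K].
Proof.
move=> K0 cK; apply: compact_has_sup; first exact: image_nonempty.
apply: continuous_compact => //; apply: continuous_subspaceT.
exact: dot_continuous.
Qed.

Lemma support_ge K x y : compact K -> K y -> dot x y <= support K x.
Proof.
move=> cK Ky; apply: sup_upper_bound; last by exists y.
by apply: support_has_sup => //; exists y.
Qed.

Lemma support_le K x b : K !=set0 -> (forall y, K y -> dot x y <= b) ->
  support K x <= b.
Proof.
move=> K0 Kb; apply: ge_sup; first exact: image_nonempty.
by move=> _ [y Ky <-]; exact: Kb.
Qed.

Definition sublinear p : Prop :=
  (forall x y, p (x + y) <= p x + p y) /\
  (forall a x, 0 < a -> p (a *: x) <= a * p x).

Lemma support_sublinear K : K !=set0 -> compact K -> sublinear (support K).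
Proof.
move=> K0 cK; split=> [x y|a x a0]; apply: support_le => // z Kz.
  by rewrite dotDl lerD// support_ge.
by rewrite dotZl ler_pM2l// support_ge.
Qed.

Lemma sublinear0 p : sublinear p -> p 0 = 0.
Proof.
move=> [pD pZ]; have := pD 0 0; have := pZ (1 / 2) 0; rewrite scaler0 addr0.
by move=> /(_ ltac:(by rewrite divr_gt0)); lra.
Qed.

Lemma sublinear_opp p x : sublinear p -> 0 <= p x + p (- x).
Proof. by move=> sp; rewrite -(sublinear0 sp) -(subrr x); exact: sp.1. Qed.

(** [q x] is the infimum of [p (x + t e) - t p e] over [t >= 0], the one-sided
    derivative of [p] at [e] in the direction [x]; subadditivity bounds these
    differences below by [- p (- x)]. *)
Lemma sublinear_tangent p e : sublinear p -> exists q,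
  [/\ sublinear q, forall x, q x <= p x & q (- e) <= - p e].
Proof.
move=> sp; have [pD pZ] := sp.
pose S x := [set s | exists2 t, 0 <= t & s = p (x + t *: e) - t * p e].
have S_mem x t : 0 <= t -> S x (p (x + t *: e) - t * p e) by exists t.
have S_lb x : lbound (S x) (- p (- x)).
  move=> _ [t t0 ->]; have := sublinear_opp (t *: e) sp.
  have [->|tn0] := eqVneq t 0.
    rewrite scale0r addr0 mul0r subr0 => _.
    have := sublinear_opp x sp; lra.
  have tgt0 : 0 < t by rewrite lt_neqAle eq_sym tn0.
  have : t * p e <= p (t *: e).
    have := pZ t^-1 (t *: e).
    rewrite scalerA mulVf// scale1r invr_gt0 => /(_ tgt0).
    by rewrite mulrC ler_pdivlMr// mulrC.
  have := pD (x + t *: e) (- x); rewrite addrAC subrr add0r; lra.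
have S_inf x t : 0 <= t -> inf (S x) <= p (x + t *: e) - t * p e.
  by move=> t0; apply: ge_inf; [exists (- p (- x))|exact: S_mem].
have S_ge x b :
    (forall t, 0 <= t -> b <= p (x + t *: e) - t * p e) -> b <= inf (S x).
  move=> Sb; apply: lb_le_inf; last by move=> _ [t t0 ->]; exact: Sb.
  by exists (p (x + 0 *: e) - 0 * p e); exact: S_mem.
exists (inf \o S); split=> [|x|] /=.
- split=> [x y|a x a0] /=.
    rewrite -lerBlDr; apply: (S_ge _ _) => t t0.
    rewrite lerBlDr -lerBlDl; apply: (S_ge _ _) => u u0.
    have := S_inf (x + y) (t + u) (addr_ge0 t0 u0).
    have := pD (x + t *: e) (y + u *: e).
    rewrite scalerDl addrACA; lra.
  rewrite -ler_pdivrMl//; apply: (S_ge _ _) => t t0.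
  have := S_inf (a *: x) (a * t); rewrite mulr_ge0 ?(ltW a0)// => /(_ isT).
  have := pZ a (x + t *: e) a0; rewrite scalerDr scalerA ler_pdivrMl//; lra.
- by have := S_inf x 0 (lexx 0); rewrite scale0r addr0 mul0r subr0.
- have := S_inf (- e) 1 ler01.
  by rewrite scale1r addNr (sublinear0 sp) mul1r sub0r.
Qed.

Lemma sublinear_linear_along p (s : seq 'rV[R]_n) : sublinear p -> exists q,
  [/\ sublinear q, forall x, q x <= p x
    & {in s, forall e, q (- e) <= - q e}].
Proof.
move=> sp; elim: s => [|e s [q [sq qp qs]]]; first by exists p; split.
have [r [sr rq re]] := sublinear_tangent e sq.
exists r; split=> // [x|f]; first exact: le_trans (qp x).
rewrite inE => /orP[/eqP ->|fs]; first by apply: le_trans re _; rewrite lerN2.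
have := qs f fs; have := rq f; have := rq (- f); lra.
Qed.

(** The Wulff shape of [p]; for a sublinear [p], the compact convex set with
    support function [p]. *)
Definition wulff p : set 'rV[R]_n := [set y | forall x, dot x y <= p x].

(** Hahn-Banach: taking tangents at [x0] and then at every basis vector ends
    with a linear minorant, because linearity along a basis is linearity; the
    tangent at [x0] makes it agree with [p] there. *)
Lemma hahn_banach p x0 : sublinear p -> exists2 y, wulff p y & dot x0 y = p x0.
Proof.
move=> sp; have [r [sr rp rx0]] := sublinear_tangent x0 sp.
have [q [sq qr qe]] :=
  sublinear_linear_along [seq delta_mx 0 j : 'rV[R]_n | j <- enum 'I_n] sr.
pose y : 'rV[R]_n := \row_j q (delta_mx 0 j).
have q_sum (I : Type) (s : seq I) (F : I -> 'rV[R]_n) :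
    q (\sum_(j <- s) F j) <= \sum_(j <- s) q (F j).
  elim: s => [|j s IH]; first by rewrite !big_nil (sublinear0 sq).
  by rewrite !big_cons; apply: le_trans (sq.1 _ _) _; rewrite lerD2l.
have q_le x : q x <= dot x y.
  rewrite {1}(matrix_sum_delta x) big_ord1; apply: le_trans (q_sum _ _ _) _.
  apply: ler_sum => j _; rewrite mxE.
  have [xj|xj|->] := ltgtP (x 0 j) 0; last first.
  - by rewrite scale0r (sublinear0 sq) mul0r.
  - exact: sq.2.
  - rewrite -[x 0 j]opprK scaleNr -scalerN mulNr.
    apply: le_trans (sq.2 _ _ _) _; first by rewrite oppr_gt0.
    rewrite -mulrN ler_pM2l ?oppr_gt0//; apply: qe.
    by apply/mapP; exists j; rewrite ?mem_enum.
have ge_q x : dot x y <= q x.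
  have := q_le (- x); have := sublinear_opp x sq; rewrite dotNl; lra.
exists y => [x|].
  exact: le_trans (ge_q x) (le_trans (qr x) (rp x)).
apply/eqP; rewrite eq_le (le_trans (ge_q _) (le_trans (qr _) (rp _)))//=.
have := ge_q (- x0); have := qr (- x0); rewrite dotNl; lra.
Qed.

Lemma support_wulff p x : sublinear p -> support (wulff p) x = p x.
Proof.
move=> sp; have [y yp yx] := hahn_banach x sp; apply/eqP; rewrite eq_le.
rewrite support_le//=; last by exists y.
rewrite -yx; apply: ub_le_sup; last by exists y.
by exists (p x) => _ [z zp <-]; exact: zp.
Qed.

Lemma wulff_convex p : convex_set (wulff p).
Proof.
apply/convex_setP => x y t xp yp t0 t1 z; rewrite dotDr !dotZr.
have -> : p z = t * p z + (1 - t) * p z by ring.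
by rewrite lerD// ler_wpM2l// subr_ge0.
Qed.

Lemma wulff_compact p : compact (wulff p).
Proof.
apply: bounded_closed_compact; last first.
  have -> : wulff p = \bigcap_(x in setT) (dot x @^-1` [set s | s <= p x]).
    by apply/seteqP; split=> [y yp x _|y yp x]; [exact: yp|exact: (yp x)].
  apply: closed_bigI => x _; apply: preimage_closed; last exact: closed_le.
  by move=> y _; exact: dot_continuous.
pose e (j : 'I_n) : 'rV[R]_n := delta_mx 0 j.
exists (\sum_j (`|p (e j)| + `|p (- e j)|)); split; first exact: num_real.
move=> b /ltW bM y yp; apply: le_trans bM.
have [->|y0] := eqVneq y 0.
  by rewrite normr0 sumr_ge0// => j _; rewrite addr_ge0.
have /mx_norm_neq0[[i j]/= yij] : mx_norm y != 0.
  by rewrite -(normr_eq0 y) in y0.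
rewrite [`|y|]yij {i yij}(ord1 i) (bigD1 j)//=.
apply: (@le_trans _ _ (`|p (e j)| + `|p (- e j)|)); last first.
  by rewrite lerDl sumr_ge0// => k _; rewrite addr_ge0.
have := yp (e j); have := yp (- e j).
rewrite dotNl dotC dot_delta => y1 y2; rewrite ler_norml.
have := ler_norm (p (e j)); have := ler_norm (p (- e j)).
have := normr_ge0 (p (e j)); have := normr_ge0 (p (- e j)).
move=> *; apply/andP; split; lra.
Qed.

(** Separation: the vector from the nearest point of [C] to [y] is the normal
    of a separating hyperplane. *)
Lemma separation C y : compact C -> convex_set C -> C !=set0 -> ~ C y ->
  exists2 x, 0 < dot x x & forall z, C z -> dot x z <= dot x y - dot x x.
Proof.
move=> cC /convex_setP vC C0 Cy; pose f z := dot (z - y) (z - y).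
have f_cont : continuous f.
  have sub_cont : continuous (fun z : 'rV[R]_n => z - y).
    move=> z; apply: continuousB; last exact: cst_continuous.
    exact: (@cvg_id _ (nbhs z)).
  move=> z.
  exact: (continuous_comp (sub_cont z) (@dot_square_continuous R n (z - y))).
have [c] := compact_EVT_min C0 cC (continuous_subspaceT f_cont).
rewrite inE => Cc fc; exists (y - c) => [|z Cz].
  rewrite dot_gt0 subr_eq0; apply/eqP => yc; apply: Cy; by rewrite yc.
pose a := dot (c - y) (z - c); pose b := dot (z - c) (z - c).
have ab t : 0 < t -> t <= 1 -> 0 <= 2 * a + t * b.
  move=> t0 t1; rewrite -(pmulr_rge0 _ t0).
  have : f c <= f (t *: z + (1 - t) *: c).
    by apply: fc; rewrite inE; apply: vC => //; exact: ltW.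
  have -> : f (t *: z + (1 - t) *: c) = f c + 2 * t * a + t ^+ 2 * b.
    rewrite /f /a /b -dot_sqrD.
    have -> // : t *: z + (1 - t) *: c - y = c - y + t *: (z - c).
    by apply/rowP => k; rewrite !mxE; ring.
  lra.
have a0 : 0 <= a.
  rewrite leNgt; apply/negP => a0.
  have b0 : 0 <= b by exact: dot_ge0.
  have ba : 0 < b - a by lra.
  (* [2 a + t b] has the sign of [a] at this [t], also when [b] is zero *)
  have := ab (- a / (b - a)).
  rewrite divr_gt0 ?oppr_gt0// ler_pdivrMr// mul1r => /(_ isT).
  have -> : - a <= b - a by lra.
  move=> /(_ isT); rewrite mulrAC -(pmulr_rge0 _ ba) mulrDr.
  rewrite [_ * (_ / _)]mulrC divfK ?gt_eqF//; nra.
move: a0; rewrite /a !(dotDl, dotDr, dotNl, dotNr).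
rewrite (dotC c y) (dotC c z) (dotC y z); lra.
Qed.

(** A compact convex set is determined by its support function. *)
Lemma wulff_support C : compact C -> convex_set C -> C !=set0 ->
  wulff (support C) = C.
Proof.
move=> cC vC C0; apply/seteqP; split=> y; last first.
  by move=> Cy x; exact: support_ge.
move=> yC; apply: contrapT => /(separation cC vC C0)[x x0 xC].
have := support_le C0 xC; have := yC x; lra.
Qed.

Lemma sum_compact K L : compact K -> compact L ->
  compact [set a + b | a in K & b in L].
Proof.
move=> cK cL.
have -> : [set a + b | a in K & b in L] = (fun u => u.1 + u.2) @` (K `*` L).
  apply/seteqP; split=> [_ [a Ka [b Lb <-]]|_ [[a b] [Ka Lb] <-]].
    by exists (a, b).
  by exists a => //; exists b.
apply: continuous_compact; last exact: compact_setX.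
apply: continuous_subspaceT; exact: add_continuous.
Qed.

Lemma sum_convex K L : convex_set K -> convex_set L ->
  convex_set [set a + b | a in K & b in L].
Proof.
move=> /convex_setP vK /convex_setP vL; apply/convex_setP.
move=> _ _ t [a Ka [b Lb <-]] [c Kc [d Ld <-]] t0 t1.
exists (t *: a + (1 - t) *: c); first exact: vK.
exists (t *: b + (1 - t) *: d); first exact: vL.
by rewrite !scalerDr addrACA.
Qed.

Lemma reflection_compact K : compact K -> compact (reflection K).
Proof.
move=> cK; apply: continuous_compact => //; apply: continuous_subspaceT.
exact: opp_continuous.
Qed.

Lemma reflection_convex K : convex_set K -> convex_set (reflection K).
Proof.
move=> /convex_setP vK; apply/convex_setP => _ _ t [x Kx <-] [y Ky <-] t0 t1.
exists (t *: x + (1 - t) *: y); first exact: vK.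
by rewrite opprD !scalerN.
Qed.

End ConvexSets.

(** * The Orlicz norm of a pair of numbers *)

Section OrliczGauge.
Variables (R : realType) (phi : R -> R).
Hypothesis hphi : orlicz_class phi.

Lemma orlicz_homo s t : 0 <= s -> s <= t -> phi s <= phi t.
Proof.
case: hphi => _ phi_lt _ _ _ s0; rewrite le_eqVlt => /orP[/eqP ->//|st].
by apply/ltW/phi_lt; rewrite // in_itv/= andbT// (le_trans s0)// ltW.
Qed.

Lemma orlicz_ltW s t : 0 <= t -> phi s <= phi t -> s <= t.
Proof.
case: hphi => _ phi_lt _ _ _ t0 st; rewrite leNgt; apply/negP => ts.
have : phi t < phi s.
  by apply: phi_lt; rewrite // in_itv/= andbT// (le_trans t0)// ltW.
by rewrite ltNge st.
Qed.

Lemma orlicz_convex a b t : 0 <= a -> 0 <= b -> 0 <= t -> t <= 1 ->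
  phi (t * a + (1 - t) * b) <= t * phi a + (1 - t) * phi b.
Proof.
case: hphi => phi_conv _ _ _ _ a0 b0 t0 t1.
by apply: (phi_conv (Itv01 t0 t1)); rewrite inE/= in_itv/= andbT.
Qed.

Lemma orlicz_le_id t : 0 <= t -> t <= 1 -> phi t <= t.
Proof.
case: (hphi) => _ _ _ phi0 phi1 t0 t1.
have := orlicz_convex ler01 (lexx 0) t0 t1.
by rewrite phi0 phi1 !mulr1 !mulr0 !addr0.
Qed.

Lemma orlicz_le1 t : 0 <= t -> phi t <= 1 -> t <= 1.
Proof.
by case: (hphi) => _ _ _ _ phi1 t0 t1; apply: orlicz_ltW => //; rewrite phi1.
Qed.

(** [phi] is continuous on [0, 1]: a point is an affine combination, with
    almost all the weight on a nearby point, of that point and a fixed one. *)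
Lemma orlicz_half : exists2 s, 0 <= s & phi s = 1 / 2.
Proof.
case: (hphi) => _ _ phi_ge0 phi0 phi1.
pose S := [set t | [/\ 0 <= t, t <= 1 & phi t <= 1 / 2]].
have S0 : S 0 by split => //; rewrite phi0 divr_ge0.
have supS : has_sup S by split; [exists 0|exists 1 => t []].
set s := sup S.
have s0 : 0 <= s by exact: sup_upper_bound supS _ S0.
have s1 : s <= 1 by apply: ge_sup; [exists 0|move=> t []].
exists s => //; apply/eqP; rewrite eq_le.
apply/andP; split; rewrite leNgt; apply/negP.
- move=> phis; pose c := phi s - 1 / 2.
  have c0 : 0 < c by rewrite subr_gt0.
  have two_ge1 : 1 <= 2 :> R by lra.
  have phi2_ge1 : 1 <= phi 2 by have := orlicz_homo ler01 two_ge1; rewrite phi1.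
  have phi2 : 0 < phi 2 by lra.
  have sgt0 : 0 < s.
    rewrite lt_neqAle s0 andbT; apply/eqP => s_eq0.
    by move: phis; rewrite -s_eq0 phi0 ltNge divr_ge0.
  have [e [e0 es ec]] : exists e, [/\ 0 < e, e <= s / 4 & e * phi 2 < c].
    exists (Num.min (s / 4) (c / (2 * phi 2))); split.
    - by rewrite lt_min !divr_gt0// mulr_gt0.
    - by rewrite ge_min lexx.
    rewrite -ltr_pdivlMr// gt_min; apply/orP; right.
    by rewrite ltr_pM2l// ltf_pV2 ?posrE ?mulr_gt0//; lra.
  have [t [t0 t1 pht] st] := sup_adherent e0 supS.
  rewrite -/s in st.
  (* [s] is the combination [(1 - r) t + r 2] with [r] small *)
  pose r := (s - t) / (2 - t).
  have ts : t <= s by apply: sup_upper_bound.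
  have t2 : 0 < 2 - t by lra.
  have r0 : 0 <= r by apply: divr_ge0; lra.
  have re : r < e by rewrite ltr_pdivrMr//; nra.
  have r1 : r <= 1 by lra.
  have := orlicz_convex (ler0n _ 2) t0 r0 r1.
  have -> : r * 2 + (1 - r) * t = s by rewrite /r; field; lra.
  have : r * phi 2 <= e * phi 2 by rewrite ler_pM2r// ltW.
  have : (1 - r) * phi t <= 1 / 2.
    have : 0 <= phi t by apply: phi_ge0; rewrite in_itv/= andbT.
    nra.
  rewrite /c in ec; lra.
- move=> phis; pose e := 1 / 2 - phi s.
  have e0 : 0 < e by rewrite subr_gt0.
  have phis0 : 0 <= phi s by apply: phi_ge0; rewrite in_itv/= andbT.
  have e1 : e <= 1 by rewrite /e; lra.
  have slt1 : s < 1.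
    rewrite lt_neqAle s1 andbT; apply/eqP => s_eq1.
    by move: phis; rewrite s_eq1 phi1; lra.
  have := orlicz_convex ler01 s0 (ltW e0) e1; rewrite phi1 => phi_e.
  have : e * 1 + (1 - e) * s <= s.
    apply: sup_upper_bound => //; split; [nra|nra|].
    apply: le_trans phi_e _; rewrite /e in e0 *; nra.
  nra.
Qed.

Lemma orlicz_inv_half : 0 < orlicz_inv phi (1 / 2) /\
  phi (orlicz_inv phi (1 / 2)) = 1 / 2.
Proof.
have [s s0 phis] := orlicz_half.
have -> : orlicz_inv phi (1 / 2) = s.
  rewrite -phis; apply: pinvKV; last by rewrite inE/= in_itv/= andbT.
  move=> a b; rewrite !inE/= !in_itv/= !andbT => a0 b0 ab.
  by apply: le_anti; apply/andP; split; apply: orlicz_ltW; rewrite // ab.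
split=> //; rewrite lt_neqAle s0 andbT; apply/eqP => s_eq0.
case: (hphi) => _ _ _ phi0 _.
by move: phis; rewrite -s_eq0 phi0; lra.
Qed.

(** The Orlicz norm of [(a, b)]; [orlicz_support] is this norm of the pair of
    support functions. *)
Definition orlicz_gauge (a b : R) : R :=
  inf [set l | 0 < l /\ phi (a / l) + phi (b / l) <= 1].

Lemma gauge_le a b l : 0 < l -> phi (a / l) + phi (b / l) <= 1 ->
  orlicz_gauge a b <= l.
Proof. by move=> l0 abl; apply: ge_inf; [exists 0 => ? [/ltW]|]. Qed.

Lemma gauge_mem a b l : 0 <= a -> 0 <= b -> 0 < l -> a + b <= l ->
  phi (a / l) + phi (b / l) <= 1.
Proof.
move=> a0 b0 l0 abl.
have al : phi (a / l) <= a / l.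
  by rewrite orlicz_le_id ?divr_ge0 ?(ltW l0)// ler_pdivrMr//; lra.
have bl : phi (b / l) <= b / l.
  by rewrite orlicz_le_id ?divr_ge0 ?(ltW l0)// ler_pdivrMr//; lra.
by apply: le_trans (lerD al bl) _; rewrite -mulrDl ler_pdivrMr// mul1r.
Qed.

Lemma gauge_ge a b c : 0 <= a -> 0 <= b ->
  (forall l, 0 < l -> phi (a / l) + phi (b / l) <= 1 -> c <= l) ->
  c <= orlicz_gauge a b.
Proof.
move=> a0 b0 abc; apply: lb_le_inf; last by move=> l [l0 abl]; exact: abc.
have l0 : 0 < a + b + 1 by rewrite ltr_wpDl// addr_ge0.
by exists (a + b + 1); split=> //; apply: gauge_mem => //; rewrite lerDl.
Qed.

Lemma gauge_le_add a b : 0 <= a -> 0 <= b -> orlicz_gauge a b <= a + b.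
Proof.
move=> a0 b0; apply/ler_addgt0Pr => e e0.
have l0 : 0 < a + b + e by rewrite ltr_wpDl// addr_ge0.
by apply: gauge_le => //; apply: gauge_mem => //; rewrite lerDl ltW.
Qed.

(** Jensen's inequality for the two values of [phi]. *)
Lemma gauge_ge_add a b : 0 <= a -> 0 <= b ->
  (2 * orlicz_inv phi (1 / 2))^-1 * (a + b) <= orlicz_gauge a b.
Proof.
move=> a0 b0; have [s0 phis] := orlicz_inv_half.
set s := orlicz_inv _ _ in s0 phis *.
apply: gauge_ge => // l l0 abl.
have al0 : 0 <= a / l by rewrite divr_ge0// ltW.
have bl0 : 0 <= b / l by rewrite divr_ge0// ltW.
have h : (1 : R) / 2 <= 1 by lra.
have h0 : 0 <= (1 : R) / 2 by lra.
have := orlicz_convex al0 bl0 h0 h.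
have -> : 1 / 2 * (a / l) + (1 - 1 / 2) * (b / l) = (a + b) / l / 2.
  by field; rewrite gt_eqF.
move=> conv; have : (a + b) / l / 2 <= s.
  by apply: orlicz_ltW; [exact: ltW|rewrite phis; lra].
rewrite ler_pdivrMr// ler_pdivrMr// => abs.
by rewrite mulrC ler_pdivrMr ?mulr_gt0//; lra.
Qed.

Lemma gauge_ge_left a b : 0 <= a -> 0 <= b -> a <= orlicz_gauge a b.
Proof.
move=> a0 b0; apply: gauge_ge => // l l0 abl.
have al0 : 0 <= a / l by rewrite divr_ge0// ltW.
case: (hphi) => _ _ phi_ge0 _ _.
have bl0 : 0 <= phi (b / l).
  by apply: phi_ge0; rewrite in_itv/= andbT divr_ge0// ltW.
have : a / l <= 1 by apply: orlicz_le1 => //; lra.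
by rewrite ler_pdivrMr// mul1r.
Qed.

Lemma gauge_homo a b a' b' : 0 <= a -> 0 <= b -> a <= a' -> b <= b' ->
  orlicz_gauge a b <= orlicz_gauge a' b'.
Proof.
move=> a0 b0 aa bb; apply: gauge_ge; [exact: le_trans aa|exact: le_trans bb|].
move=> l l0 abl; apply: gauge_le => //; apply: le_trans abl.
apply: lerD; apply: orlicz_homo; rewrite ?divr_ge0 ?(ltW l0)//;
  by rewrite ler_pM2r ?invr_gt0.
Qed.

Lemma gauge_add a b a' b' : 0 <= a -> 0 <= b -> 0 <= a' -> 0 <= b' ->
  orlicz_gauge (a + a') (b + b') <= orlicz_gauge a b + orlicz_gauge a' b'.
Proof.
move=> a0 b0 a'0 b'0.
rewrite -lerBlDr; apply: gauge_ge => // l l0 abl.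
rewrite lerBlDr -lerBlDl; apply: gauge_ge => // l' l'0 abl'.
rewrite lerBlDl; have ll : 0 < l + l' by rewrite addr_gt0.
apply: gauge_le => //; pose t := l / (l + l').
have t0 : 0 <= t by rewrite divr_ge0// ltW.
have t1 : t <= 1 by rewrite ler_pdivrMr// mul1r lerDl ltW.
have split_div x x' : (x + x') / (l + l') = t * (x / l) + (1 - t) * (x' / l').
  by rewrite /t; field; rewrite !gt_eqF.
have dv (x u : R) : 0 <= x -> 0 < u -> 0 <= x / u.
  by move=> x0 u0; rewrite divr_ge0// ltW.
rewrite !split_div.
have := orlicz_convex (dv _ _ a0 l0) (dv _ _ a'0 l'0) t0 t1.
have := orlicz_convex (dv _ _ b0 l0) (dv _ _ b'0 l'0) t0 t1.
nra.
Qed.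

Lemma gauge_scale a b c : 0 < c -> 0 <= a -> 0 <= b ->
  orlicz_gauge (c * a) (c * b) <= c * orlicz_gauge a b.
Proof.
move=> c0 a0 b0; rewrite -ler_pdivrMl//; apply: gauge_ge => // l l0 abl.
rewrite ler_pdivrMl//; apply: gauge_le; first exact: mulr_gt0.
by rewrite -!mulf_div divff ?gt_eqF// !mul1r.
Qed.

End OrliczGauge.

(** * The Orlicz sum lies between multiples of the Minkowski sum *)

Section OrliczSum.
Variables (R : realType) (n : nat) (phi : R -> R) (K L : set 'rV[R]_n).
Hypotheses (hphi : orlicz_class phi) (hK : convex_body_o K).
Hypotheses (cL : compact L) (vL : convex_set L) (L0 : L 0).

Let cK : compact K. Proof. by case: hK => -[]. Qed.
Let vK : convex_set K. Proof. by case: hK => -[]. Qed.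
Let K0 : K 0. Proof. by case: hK. Qed.
Let Kne : K !=set0. Proof. by exists 0. Qed.
Let Lne : L !=set0. Proof. by exists 0. Qed.

Let hK_ge0 x : 0 <= support K x.
Proof. by rewrite -(dot0r x) support_ge. Qed.

Let hL_ge0 x : 0 <= support L x.
Proof. by rewrite -(dot0r x) support_ge. Qed.

Lemma orlicz_support_sublinear : sublinear (orlicz_support phi K L).
Proof.
have [KD KZ] := support_sublinear Kne cK.
have [LD LZ] := support_sublinear Lne cL.
split=> [x y|a x a0].
  apply: le_trans (gauge_add hphi _ _ _ _) => //.
  by apply: gauge_homo.
apply: le_trans (gauge_scale hphi a0 _ _) => //.
by apply: gauge_homo => //; [exact: KZ|exact: LZ].
Qed.

Lemma orlicz_sum_wulff : orlicz_sum phi K L = wulff (orlicz_support phi K L).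
Proof.
set H := orlicz_support phi K L.
have sH : sublinear H := orlicz_support_sublinear.
have bH : convex_body (wulff H).
  split; [exact: wulff_compact|exact: wulff_convex|].
  case: hK => -[_ _ [z Kz]] _; exists z; apply: interiorS Kz => y Ky x.
  by apply: le_trans (gauge_ge_left hphi _ _) => //; exact: support_ge.
have [[cM vM [z Mz]] hM] : convex_body (orlicz_sum phi K L) /\
    forall x, support (orlicz_sum phi K L) x = H x.
  apply: (@xgetPex _ set0 [set M | convex_body M /\
    forall x, support M x = H x]).
  by exists (wulff H); split=> // x; exact: support_wulff.
rewrite -[LHS]wulff_support//; last by exists z; exact: interior_subset Mz.
by congr wulff; apply/funext.
Qed.

Lemma orlicz_sum_sub y : orlicz_sum phi K L y ->
  exists2 a, K a & exists2 b, L b & y = a + b.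
Proof.
rewrite orlicz_sum_wulff => yH.
have : [set a + b | a in K & b in L] y.
  rewrite -[X in X y]wulff_support.
  - move=> x; apply: le_trans (yH x) _.
    apply: le_trans (gauge_le_add hphi _ _) _ => //.
    rewrite -lerBrDr; apply: support_le => // a Ka.
    rewrite lerBrDr -lerBrDl; apply: support_le => // b Lb.
    rewrite lerBrDl -dotDr; apply: support_ge; first exact: sum_compact.
    by exists a => //; exists b.
  - exact: sum_compact.
  - exact: sum_convex.
  - by exists (0 + 0); exists 0 => //; exists 0.
by move=> [a Ka [b Lb <-]]; exists a => //; exists b.
Qed.

Lemma sub_orlicz_sum a b : K a -> L b ->
  orlicz_sum phi K L ((2 * orlicz_inv phi (1 / 2))^-1 *: (a + b)).
Proof.
move=> Ka Lb; rewrite orlicz_sum_wulff => x.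
apply: le_trans (gauge_ge_add hphi _ _) => //.
have [s0 _] := orlicz_inv_half hphi.
rewrite dotZr ler_pM2l ?invr_gt0 ?mulr_gt0// dotDr.
by apply: lerD; exact: support_ge.
Qed.

End OrliczSum.

(** * Orthogonal projections in coordinates *)

Section Projections.
Variables (R : realType) (n i : nat) (E : 'M[R]_(i, n)) (L : {vspace 'rV[R]_n}).
Hypothesis EL : orthonormal_rows E L.

Lemma dot_isometry (u v : 'rV[R]_i) : dot (u *m E) (v *m E) = dot u v.
Proof.
by rewrite !dotE trmx_mul mulmxA -(mulmxA u) EL.1 mulmx1.
Qed.

Lemma proj_in (x : 'rV[R]_n) : x *m E^T *m E \in L.
Proof.
by apply/EL.2; rewrite -!mulmxA (mulmxA E) EL.1 mul1mx.
Qed.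

Lemma row_in (j : 'I_i) : row j E \in L.
Proof. by apply/EL.2; rewrite -row_mul EL.1 -row_mul mul1mx. Qed.

Lemma dot_row (x : 'rV[R]_n) (j : 'I_i) : dot x (row j E) = (x *m E^T) 0 j.
Proof. by rewrite mxE; apply: eq_bigr => k _; rewrite !mxE. Qed.

Lemma sub_proj_orthocomp (x : 'rV[R]_n) : orthocomp L (x - x *m E^T *m E).
Proof.
move=> y yL; rewrite dotDl dotNl; apply/eqP; rewrite subr_eq0; apply/eqP.
move/EL.2 : yL => <-.
by rewrite dot_isometry !dotE !trmx_mul trmxK !mulmxA.
Qed.

Lemma projectionE (K : set 'rV[R]_n) :
  projection K L = [set x *m E^T *m E | x in K].
Proof.
apply/seteqP; split=> [p [pL [x Kx xp]]|_ [x Kx <-]].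
  exists x => //; have /EL.2 pE := pL; rewrite -[RHS]pE; congr (_ *m E).
  apply/eqP; rewrite -subr_eq0 -mulmxBl; apply/eqP/rowP => j.
  by rewrite -dot_row xp ?mxE//; exact: row_in.
split; first exact: proj_in.
by exists x => //; exact: sub_proj_orthocomp.
Qed.

Lemma proj_contract (x : 'rV[R]_n) :
  dot (x *m E^T *m E) (x *m E^T *m E) <= dot x x.
Proof.
have : dot (x - x *m E^T *m E) (x *m E^T *m E) = 0.
  by apply: sub_proj_orthocomp; exact: proj_in.
have := dot_ge0 (x - x *m E^T *m E); move: (x *m E^T *m E) => p.
rewrite !(dotDl, dotDr, dotNl, dotNr) (dotC p x); lra.
Qed.

Lemma dot_row_row (j k : 'I_i) : dot (row j E) (row k E) = (j == k)%:R.
Proof. by rewrite dot_row -row_mul EL.1 !mxE. Qed.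

End Projections.

(** * Outer and inner radii of a body and of its difference body *)

Section Radii.
Variables (R : realType) (n : nat).
Implicit Types (K M : set 'rV[R]_n) (L : {vspace 'rV[R]_n}).

Definition ebounded M : Prop :=
  exists2 b : R, 0 <= b & forall x, M x -> dot x x <= b ^+ 2.

Lemma compact_ebounded M : compact M -> ebounded M.
Proof.
move=> /compact_bounded[N [_ MN]]; pose b : R := n%:R * (`|N| + 1) ^+ 2.
have b0 : 0 <= b by rewrite mulr_ge0// sqr_ge0.
exists (Num.sqrt b) => [|x Mx]; first exact: sqrtr_ge0.
rewrite sqr_sqrtr//; apply: le_trans (dot_le_norm x) _.
rewrite ler_wpM2l// ler_pXn2r ?nnegrE ?addr_ge0//.
by apply: MN => //; rewrite (le_lt_trans (ler_norm N))// ltrDl.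
Qed.

Lemma subspace_exists (i : nat) : (i <= n)%N ->
  exists L : {vspace 'rV[R]_n}, \dim L = i.
Proof.
move=> le_in; pose X := vbasis (fullv : {vspace 'rV[R]_n}).
have sX : size X = n by rewrite size_tuple dimvf /dim/= mul1n.
exists <<take i X>>%VS; apply/eqP.
have : free (take i X ++ drop i X).
  by rewrite cat_take_drop (basis_free (vbasisP _)).
by move=> /catl_free; rewrite /free size_takel ?sX.
Qed.

Lemma circumradius_le M c r : 0 <= r -> M `<=` eball c r -> circumradius M <= r.
Proof.
by move=> r0 Mr; apply: ge_inf; [exists 0 => ? []|split=> //; exists c].
Qed.

Lemma circumradius_ge M b : ebounded M ->
  (forall c r, 0 <= r -> M `<=` eball c r -> b <= r) -> b <= circumradius M.
Proof.
move=> [d d0 Md] Mb; apply: lb_le_inf; last by move=> r [r0 [c Mc]]; exact: (Mb c).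
exists d; split=> //; exists 0 => x Mx.
by rewrite /eball/= subr0 enorm_le// Md.
Qed.

Lemma circumradius_ge0 M : 0 <= circumradius M.
Proof.
set S := [set rho : R | 0 <= rho /\ exists c, M `<=` eball c rho].
have [S0|/set0P S0] := eqVneq S set0.
  by rewrite /circumradius -/S S0 inf0.
by apply: lb_le_inf => // r [].
Qed.

Lemma outer_radius_le i M L b : \dim L = i ->
  circumradius (projection M L) <= b -> outer_radius i M <= b.
Proof.
move=> dL; apply: le_trans; apply: ge_inf; last by exists L.
by exists 0 => _ [L' _ <-]; exact: circumradius_ge0.
Qed.

Lemma outer_radius_ge i M b : (i <= n)%N ->
  (forall L, \dim L = i -> b <= circumradius (projection M L)) ->
  b <= outer_radius i M.
Proof.
move=> /subspace_exists[L dL] Mb; apply: lb_le_inf.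
  by exists (circumradius (projection M L)), L.
by move=> _ [L' dL' <-]; exact: Mb.
Qed.

Lemma projection_ebounded M L : ebounded M -> ebounded (projection M L).
Proof.
move=> [b b0 Mb]; have [E EL] := @orthonormal_basis R n _ L erefl.
exists b => // p; rewrite (projectionE EL) => -[x Mx <-].
exact: le_trans (proj_contract EL x) (Mb x Mx).
Qed.

Lemma outer_radius_difference_le i K M : (i <= n)%N -> ebounded K ->
  (forall y, M y -> exists2 a, K a & exists2 b, K b & y = a - b) ->
  outer_radius i M <= 2 * outer_radius i K.
Proof.
move=> le_in bK MK; rewrite -ler_pdivrMl//.
apply: outer_radius_ge => // L dL.
apply: circumradius_ge => [|c r r0 Kr]; first exact: projection_ebounded.
rewrite ler_pdivrMl//; apply: (outer_radius_le dL).
have [E EL] := orthonormal_basis dL.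
have r20 : 0 <= 2 * r by rewrite mulr_ge0.
apply: (@circumradius_le _ 0) => // p; rewrite (projectionE EL).
move=> [y /MK[a Ka [b Kb ->]] <-]; rewrite /eball/= subr0 enorm_le//.
have Kball x : K x -> dot (x *m E^T *m E - c) (x *m E^T *m E - c) <= r ^+ 2.
  by move=> Kx; rewrite -enorm_le//; apply: Kr; rewrite (projectionE EL); exists x.
have -> : (a - b) *m E^T *m E = (a *m E^T *m E - c) - (b *m E^T *m E - c).
  by rewrite !mulmxBl opprB addrA addrNK.
rewrite exprMn -natrX; exact: dot_subr_le (Kball a Ka) (Kball b Kb).
Qed.

(** A difference body is symmetric, so the circumradius of its projection
    bounds the diameter of the projection of the body itself; Jung's theorem
    in the subspace then bounds the circumradius of the latter. *)
Lemma outer_radius_difference_ge i K M l : (1 <= i <= n)%N -> 0 < l ->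
  ebounded M -> (forall a b, K a -> K b -> M (l *: (a - b))) ->
  l * (Num.sqrt 2 * Num.sqrt (i.+1%:R / i%:R)) * outer_radius i K
    <= outer_radius i M.
Proof.
move=> /andP[i1 le_in] l0 bM KM; apply: outer_radius_ge => // L dL.
apply: circumradius_ge => [|c r r0 Mr]; first exact: projection_ebounded.
have [E EL] := orthonormal_basis dL.
set k := Num.sqrt 2 * Num.sqrt _.
have i0 : 0 < i%:R :> R by rewrite ltr0n.
have k0 : 0 < k by rewrite mulr_gt0 ?sqrtr_gt0// divr_gt0.
have k2 : k ^+ 2 = 2 * (i.+1%:R / i%:R).
  by rewrite exprMn !sqr_sqrtr// divr_ge0.
rewrite leNgt; apply/negP => lt_r.
have lk0 : 0 < l * k by rewrite mulr_gt0.
set q := r / (l * k).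
have q0 : 0 <= q by rewrite divr_ge0// ltW.
have qK : q < outer_radius i K by rewrite ltr_pdivrMr// mulrC.
set r' := (q + outer_radius i K) / 2.
have qr' : q < r' by rewrite /r'; lra.
have r'0 : 0 <= r' by rewrite (le_trans q0)// ltW.
pose C : set 'rV[R]_i := [set x *m E^T | x in K].
have CD x y : C x -> C y -> dot (x - y) (x - y) <= (r / l) ^+ 2.
  move=> [a Ka <-] [b Kb <-]; pose p := l *: (a *m E^T *m E - b *m E^T *m E).
  have ball s t : K s -> K t ->
      dot (l *: (s *m E^T *m E - t *m E^T *m E) - c)
          (l *: (s *m E^T *m E - t *m E^T *m E) - c) <= r ^+ 2.
    move=> Ks Kt; rewrite -enorm_le//; apply: Mr; rewrite (projectionE EL).
    exists (l *: (s - t)); first exact: KM.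
    by rewrite -!scalemxAl !mulmxBl.
  have := dot_subr_le (ball a b Ka Kb) (ball b a Kb Ka).
  have -> : l *: (a *m E^T *m E - b *m E^T *m E) - c
      - (l *: (b *m E^T *m E - a *m E^T *m E) - c)
      = (2 * l) *: ((a *m E^T - b *m E^T) *m E).
    by rewrite mulmxBl; apply/rowP => j; rewrite !mxE; ring.
  rewrite dotZl dotZr (dot_isometry EL) expr_div_n.
  rewrite ler_pdivlMr ?exprn_gt0//; lra.
have Dr : (r / l) ^+ 2 * (i%:R / (2 * i.+1%:R)) < r' ^+ 2.
  have -> : (r / l) ^+ 2 * (i%:R / (2 * i.+1%:R)) = q ^+ 2.
    rewrite /q !expr_div_n exprMn k2; field.
    by rewrite !gt_eqF// ltr0n.
  by rewrite ltr_pXn2r ?nnegrE.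
have [c' Cc'] := jung r'0 CD Dr.
suff : outer_radius i K <= r' by rewrite /r' in qr' *; lra.
apply: (outer_radius_le dL); apply: (@circumradius_le _ (c' *m E)) => // p.
rewrite (projectionE EL) => -[x Kx <-]; rewrite /eball/= enorm_le//.
rewrite -mulmxBl (dot_isometry EL) -enorm_le//; apply: Cc'.
by exists x.
Qed.

Definition flat_ball K L (c : 'rV[R]_n) (r : R) : Prop :=
  forall v, v \in L -> dot v v <= r ^+ 2 -> K (c + v).

Lemma flat_ball_translate K L x c r : 0 <= r -> translate x L c ->
  flat_ball K L c r <->
  eball c r `&` translate x L `<=` K `&` translate x L.
Proof.
move=> r0 [v0 v0L <-]; split=> [ball y [yr [v vL yv]]|ball v vL vr].
  split; last by exists v.
  rewrite -[y](subrK (x + v0)) addrC; apply: ball.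
    by rewrite -yv opprD addrACA subrr add0r memvB.
  by rewrite -enorm_le.
have [] // := ball (x + v0 + v); split.
  by rewrite /eball/= addrC addKr enorm_le.
by exists (v0 + v); [exact: memvD|rewrite addrA].
Qed.

Lemma flat_ball_radius_le i K L c r b : (0 < i)%N -> \dim L = i -> 0 <= r ->
  0 <= b -> (forall x, K x -> dot x x <= b ^+ 2) -> flat_ball K L c r -> r <= b.
Proof.
case: i => // i _ dL r0 b0 Kb ball; have [E EL] := orthonormal_basis dL.
set e := row ord0 E; have eL : e \in L := row_in EL ord0.
have e1 : dot e e = 1 by rewrite (dot_row_row EL) eqxx.
have K1 : K (c + r *: e).
  by apply: ball; rewrite ?memvZ// dotZl dotZr e1 mulr1 expr2.
have K2 : K (c + (- r) *: e).
  by apply: ball; rewrite ?memvZ// dotZl dotZr e1 mulr1 mulrNN expr2.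
have := dot_subr_le (Kb _ K1) (Kb _ K2).
have -> : c + r *: e - (c + (- r) *: e) = (2 * r) *: e.
  by apply/rowP => j; rewrite !mxE; ring.
rewrite dotZl dotZr e1 mulr1 => rb.
by rewrite -(@ler_pXn2r _ 2) ?nnegrE//; lra.
Qed.

Lemma sup_le_ge0 (S : set R) b : 0 <= b -> ubound S b -> sup S <= b.
Proof.
move=> b0 Sb; have [->|/set0P S0] := eqVneq S set0; first by rewrite sup0.
exact: ge_sup.
Qed.

Lemma inner_radius_le i K b : 0 <= b ->
  (forall L c r, \dim L = i -> 0 <= r -> flat_ball K L c r -> r <= b) ->
  inner_radius i K <= b.
Proof.
move=> b0 Kb; apply: sup_le_ge0 => // _ [L dL <-].
apply: sup_le_ge0 => // _ [x xL <-]; apply: sup_le_ge0 => // r [r0 [c cT ball]].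
by apply: (Kb L c r) => //; apply/(flat_ball_translate K r0 cT).
Qed.

Lemma inner_radius_ge i K L c r : (0 < i)%N -> ebounded K -> \dim L = i ->
  0 <= r -> flat_ball K L c r -> r <= inner_radius i K.
Proof.
move=> i0 [b b0 Kb] dL r0 ball; have [E EL] := orthonormal_basis dL.
pose rel L' x := [set rho : R | 0 <= rho /\ exists2 c', translate x L' c'
  & eball c' rho `&` translate x L' `<=` K `&` translate x L'].
have rel_ub L' x : \dim L' = i -> ubound (rel L' x) b.
  move=> dL' r' [r'0 [c' cT /(flat_ball_translate K r'0 cT) ball']].
  exact: flat_ball_radius_le i0 dL' r'0 b0 Kb ball'.
pose rads L' := [set rel_inradius (K `&` translate x L') (translate x L')
                | x in orthocomp L'].
have rads_ub L' : \dim L' = i -> ubound (rads L') b.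
  by move=> dL' _ [x _ <-]; apply: sup_le_ge0 => //; exact: rel_ub.
pose x := c - c *m E^T *m E.
have xL : orthocomp L x := @sub_proj_orthocomp _ _ _ _ _ EL c.
have cT : translate x L c.
  by exists (c *m E^T *m E); [exact: proj_in EL c|rewrite subrK].
apply: (@le_trans _ _ (sup (rads L))); last first.
  apply: ub_le_sup; last by exists L.
  by exists b => _ [L' dL' <-]; apply: sup_le_ge0 => //; exact: rads_ub.
apply: (@le_trans _ _ (sup (rel L x))); last first.
  by apply: ub_le_sup; [exists b; exact: rads_ub|exists x].
apply: ub_le_sup; first by exists b; exact: rel_ub.
by split=> //; exists c => //; apply/(flat_ball_translate K r0 cT).
Qed.

Lemma inner_radius_ge0 i K x : (1 <= i <= n)%N -> ebounded K -> K x ->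
  0 <= inner_radius i K.
Proof.
move=> /andP[i0 /subspace_exists[L dL]] bK Kx.
apply: (@inner_radius_ge i K L x) => // v _; rewrite expr0n/= => v0.
have /eqP : dot v v = 0 by apply/eqP; rewrite eq_le v0 dot_ge0.
by rewrite dot_eq0 => /eqP ->; rewrite addr0.
Qed.

Lemma inner_radius_gt0 i K : (1 <= i <= n)%N -> ebounded K ->
  interior K !=set0 -> 0 < inner_radius i K.
Proof.
move=> /andP[i0 /subspace_exists[L dL]] bK [c].
rewrite /interior/= => /nbhs_normP[e /= e0 eK].
have e20 : 0 < e / 2 by rewrite divr_gt0.
apply: (lt_le_trans e20); apply: (@inner_radius_ge i K L c) => //.
  exact: ltW.
move=> v _ ve; apply: eK; rewrite /= opprD addNKr normrN.
have : `|v| <= e / 2.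
  rewrite -(@ler_pXn2r _ 2) ?nnegrE// ?(ltW e20)//.
  exact: le_trans (norm_le_dot v) ve.
lra.
Qed.

Lemma inner_radius_difference_ge i K M l : (1 <= i <= n)%N -> 0 < l ->
  K !=set0 -> ebounded M -> (forall a b, K a -> K b -> M (l *: (a - b))) ->
  2 * l * inner_radius i K <= inner_radius i M.
Proof.
move=> hi l0 [x Kx] bM KM; have /andP[i0 _] := hi.
have l20 : 0 < 2 * l by rewrite mulr_gt0.
have M0 : 0 <= inner_radius i M := inner_radius_ge0 hi bM (KM _ _ Kx Kx).
rewrite -ler_pdivlMl//; apply: inner_radius_le => [|L c r dL r0 ball].
  by rewrite mulr_ge0// invr_ge0 ltW.
rewrite ler_pdivlMl//; apply: (@inner_radius_ge i M L 0) => //.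
  by rewrite mulr_ge0// ltW.
move=> v vL vr; pose w := (2 * l)^-1 *: v.
have wL : w \in L by exact: memvZ.
have wr : dot w w <= r ^+ 2.
  rewrite /w dotZl dotZr mulrA -expr2 exprVn ler_pdivrMl ?exprn_gt0//.
  by rewrite -exprMn.
have Kp := ball w wL wr.
have Km : K (c - w) by apply: ball; rewrite ?rpredN// dotNl dotNr opprK.
have -> : 0 + v = l *: (c + w - (c - w)); last exact: KM.
apply/rowP => k; rewrite !mxE; field; by rewrite gt_eqF.
Qed.

(** An [i]-ball of radius [r] in the difference body provides, for each vector
    [e j] of an orthonormal basis of its direction, a segment of [K] with
    direction and length [r e j]. The mean of these [i] orthogonal segments is
    a cube inside [K], and the ball inscribed in the cube has radius
    [r / (2 i)]. *)
Lemma inner_radius_difference_le i K M : (1 <= i <= n)%N -> K !=set0 ->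
  ebounded K -> convex_set K ->
  (forall y, M y -> exists2 a, K a & exists2 b, K b & y = a - b) ->
  inner_radius i M <= 2 * i%:R * inner_radius i K.
Proof.
move=> hi [x Kx] bK vK MK; have /andP[i1 _] := hi; have /convex_setP vK' := vK.
have i0 : 0 < 2 * i%:R :> R by rewrite mulr_gt0// ltr0n.
have rK0 : 0 <= inner_radius i K := inner_radius_ge0 hi bK Kx.
apply: inner_radius_le => [|L c r dL]; first by rewrite mulr_ge0// ltW.
rewrite le_eqVlt => /orP[/eqP <- _|r0 ball]; first by rewrite mulr_ge0// ltW.
have [E EL] := orthonormal_basis dL; pose e j := row j E.
have segment j : exists u : 'rV[R]_n * 'rV[R]_n,
    [/\ K u.1, K u.2 & u.1 - u.2 = r *: e j].
  have eL : e j \in L := row_in EL j.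
  have e1 : dot (e j) (e j) = 1 by rewrite (dot_row_row EL) eqxx.
  have /MK[a Ka [b Kb ab]] : M (c + r *: e j).
    by apply: ball; rewrite ?memvZ// dotZl dotZr e1 mulr1 expr2.
  have /MK[a' Ka' [b' Kb' ab']] : M (c + (- r) *: e j).
    by apply: ball; rewrite ?memvZ// dotZl dotZr e1 mulr1 mulrNN expr2.
  have h0 : 0 <= (1 : R) / 2 by lra.
  have h1 : (1 : R) / 2 <= 1 by lra.
  exists (1 / 2 *: a + (1 - 1 / 2) *: b', 1 / 2 *: a' + (1 - 1 / 2) *: b).
  split; [exact: vK'|exact: vK'|].
  have -> : r *: e j = 1 / 2 *: (c + r *: e j - (c + (- r) *: e j)).
    by apply/rowP => k; rewrite !mxE; field.
  by rewrite ab ab' /=; apply/rowP => k; rewrite !mxE; field.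
have [f fP] := choice segment.
pose z := i%:R^-1 *: \sum_j (1 / 2) *: ((f j).1 + (f j).2).
rewrite -ler_pdivrMl//; apply: (@inner_radius_ge i K L z) => //.
  by rewrite mulr_ge0 ?invr_ge0// ltW.
move=> v vL vr; pose t j := i%:R * dot v (e j) / r.
have vE : v = \sum_j dot v (e j) *: e j.
  have /EL.2 vE := vL; rewrite -[LHS]vE mulmx_sum_row.
  by apply: eq_bigr => j _; rewrite dot_row.
have t_small j : - (1 / 2) <= t j <= 1 / 2.
  have : dot v (e j) ^+ 2 <= ((2 * i%:R)^-1 * r) ^+ 2.
    apply: le_trans vr.
    have := dot_ge0 (v - dot v (e j) *: e j).
    have e1 : dot (e j) (e j) = 1 by rewrite (dot_row_row EL) eqxx.
    rewrite -scaleNr dot_sqrD e1; lra.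
  have q0 : 0 <= (2 * i%:R)^-1 * r by rewrite mulr_ge0 ?invr_ge0// ltW.
  rewrite -ler_sqrt ?sqr_ge0// !sqrtr_sqr (ger0_norm q0) => tj.
  have : `|t j| <= 1 / 2.
    rewrite /t !normrM normfV (gtr0_norm r0) ler_pdivrMr// ger0_norm//.
    apply: le_trans (ler_wpM2l _ tj) _ => //.
    have -> // : i%:R * ((2 * i%:R)^-1 * r) = 1 / 2 * r.
    by field; rewrite pnatr_eq0 -lt0n.
  by rewrite ler_norml.
have -> : z + v = i%:R^-1 *:
    \sum_j ((1 / 2 + t j) *: (f j).1 + (1 - (1 / 2 + t j)) *: (f j).2).
  rewrite /z [in LHS]vE -[X in _ + X](@scalerK _ _ i%:R); last first.
    by rewrite pnatr_eq0 -lt0n.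
  rewrite -scalerDr; congr (_ *: _); rewrite scaler_sumr -big_split/=.
  apply: eq_bigr => j _; have [_ _ fj] := fP j.
  have -> : i%:R *: (dot v (e j) *: e j) = t j *: (r *: e j).
    by rewrite !scalerA /t divfK ?gt_eqF.
  by rewrite -fj; apply/rowP => k; rewrite !mxE; field.
case: i i1 {hi i0 rK0 dL} E EL e segment f fP z vr t vE t_small.
  by [].
move=> i _ E EL e segment f fP z vr t vE t_small.
apply: convex_mean => // j; have [f1 f2 _] := fP j.
have /andP[t1 t2] := t_small j.
by apply: vK' => //; lra.
Qed.

End Radii.

Theorem theorem0p5 (R : realType) (n : nat) (phi : R -> R) (K : set 'rV[R]_n)
    (hphi : orlicz_class phi) (hK : convex_body_o K)
    (i : nat) (hi : (1 <= i <= n)%N) :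
  [/\ Num.sqrt 2 / (2 * orlicz_inv phi (1 / 2)) * Num.sqrt (i.+1%:R / i%:R)
        * outer_radius i K
      <= outer_radius i (orlicz_sum phi K (reflection K)),
      outer_radius i (orlicz_sum phi K (reflection K))
      <= 2 * outer_radius i K,
      1 / orlicz_inv phi (1 / 2) * inner_radius i K
      <= inner_radius i (orlicz_sum phi K (reflection K))
    & inner_radius i (orlicz_sum phi K (reflection K))
      < 2 * (i.+1)%:R * inner_radius i K].
Proof.
have [[cK vK iK] K0] := hK.
have Kne : K !=set0 by exists 0.
have cR := reflection_compact cK; have vR := reflection_convex vK.
have R0 : reflection K 0 by exists 0; rewrite ?oppr0.
have [s0 _] := orlicz_inv_half hphi.
have bK := compact_ebounded cK.
have M_sub y : orlicz_sum phi K (reflection K) y ->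
    exists2 a, K a & exists2 b, K b & y = a - b.
  move=> /(orlicz_sum_sub hphi hK cR vR R0)[a Ka [_ [b Kb <-] ->]].
  by exists a => //; exists b.
have sub_M a b : K a -> K b -> orlicz_sum phi K (reflection K)
    ((2 * orlicz_inv phi (1 / 2))^-1 *: (a - b)).
  by move=> Ka Kb; apply: sub_orlicz_sum => //; exists b.
have bM : ebounded (orlicz_sum phi K (reflection K)).
  rewrite (orlicz_sum_wulff hphi hK cR R0).
  by apply: compact_ebounded; exact: wulff_compact.
have l0 : 0 < (2 * orlicz_inv phi (1 / 2))^-1 by rewrite invr_gt0 mulr_gt0.
have /andP[i1 le_in] := hi.
split.
- have := outer_radius_difference_ge hi l0 bM sub_M.
  by rewrite mulrA [_^-1 * _]mulrC.
- exact: outer_radius_difference_le le_in bK M_sub.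
- have := inner_radius_difference_ge hi l0 Kne bM sub_M.
  by rewrite invfM mulrA divff// mul1r div1r.
- apply: le_lt_trans (inner_radius_difference_le hi Kne bK vK M_sub) _.
  rewrite ltr_pM2r; last exact: inner_radius_gt0.
  by rewrite ltr_pM2l// ltr_nat.
Qed.
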